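(* Assume the polytopic dynamics described in the context, and suppose that $\eta>0$, $\mathcal{M}[\|\psi_0\|^2]<\infty$, and $\mathcal{M}[\|\psi_k\|^2]<\infty$ for $k\in\{1,\dots,K\}$. Let $$v(w,\theta)=-\Big(\sum_{k=1}^K\sum_{k'=1}^K h_k(\theta)h_{k'}(\theta)L_{k,k'}(w)\Big)^{-1}\sum_{k=1}^K h_k(\theta)\,l_k(w).$$ Then for any $w\in\mathbb{R}^{d_w}$ and any $\theta\in\mathbb{S}_\theta$, the gradient of the expected approximate cost is given, for each component $[w]_j$ of $w$, by $$\frac{\partial}{\partial [w]_j}\mathrm{E}_{x_0}\big[\hat J(x_0,v(w,\theta))\big]=-\mathrm{E}_{x_0}[\phi(x_0)]^\top\Big(\sum_{k=1}^K\sum_{k'=1}^K h_k(\theta)h_{k'}(\theta)L_{k,k'}(w)\Big)^{-1}\sum_{k=1}^K h_k(\theta)\Big(\frac{\partial l_k(w)}{\partial [w]_j}+\sum_{k'=1}^K h_{k'}(\theta)\frac{\partial L_{k,k'}(w)}{\partial [w]_j}\,v(w,\theta)\Big).$$ Furthermore, the assumption $\eta>0$ is not needed (i.e. $\eta\ge0$ suffices) if $L_{k,k'}(\cdot)\succ0$ holds in a neighborhood of $w$ for all $k,k'\in\{1,\dots,K\}$.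
   Context: Notation. $\mathrm{vec}$ is column-stacking vectorization, $\otimes$ the Kronecker product, $I_n$ the $n\times n$ identity, $\partial\phi(x)/\partial x^\top\in\mathbb{R}^{d_v\times d_x}$ the Jacobian. $L\succ0$ means $y^\top Ly>0$ for all nonzero $y$. $\mathrm{E}_{x_0}$ is expectation over the random initial state $x_0\in\mathbb{R}^{d_x}$, whose distribution has finite expectation of every monomial of $x_0$; the vector $\mathrm{E}_{x_0}[\phi(x_0)]$ appearing in the formula is understood to be well-defined and finite. Dynamics. $\mathbb{S}_\theta\subseteq\mathbb{R}^{d_\theta}$ is a given set. Polytopic dynamics: there are a positive integer $K$, continuous $h_k:\mathbb{S}_\theta\to[0,1]$ with $\sum_{k=1}^K h_k(\theta)=1$, and locally Lipschitz $f_k:\mathbb{R}^{d_x}\to\mathbb{R}^{d_x}$ with $f_k(0)=0$ and $G_k:\mathbb{R}^{d_x}\to\mathbb{R}^{d_x\times d_u}$, such that the system $\dot x=f(x,\theta)+G(x,\theta)u(x)$ has $f(x,\theta)=\sum_k h_k(\theta)f_k(x)$ and $G(x,\theta)=\sum_k h_k(\theta)G_k(x)$. Cost terms. $q:\mathbb{R}^{d_x}\to\mathbb{R}$ is continuous and globally positive definite ($q(0)=0$, $q(x)>0$ for $x\neq0$, $\lim_{\|x\|\to\infty}q(x)\ne0$); $R:\mathbb{R}^{d_x}\to\mathbb{R}^{d_u\times d_u}$ is continuous with symmetric positive definite values. Parameterization. $\Phi:\mathbb{R}^{d_x}\to\mathbb{R}^{d_w\times d_u}$ is locally Lipschitz,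 $\phi:\mathbb{R}^{d_x}\to\mathbb{R}^{d_v}$ is $C^1$ with $\phi(0)=0$; $\hat J(x,\tilde v):=\phi(x)^\top\tilde v$. Operator $\mathcal{M}$. For continuous $\pi:\mathbb{R}^{d_x}\to\mathbb{R}^{n\times m}$, $\mathcal{M}[\pi]:=\int_{\mathbb{R}^{d_x}}\mathcal{P}(x)\pi(x)\,dx$, where $\mathcal{P}:\mathbb{R}^{d_x}\to[0,\infty]$ is a predefined weight function such that $\mathcal{M}$ is linear, bounded, and well-defined for every such $\pi$. The constant $\eta\ge0$ is a free parameter. Auxiliary functions. $$\psi_0(x):=\begin{bmatrix} q(x)\\ \mathrm{vec}\big(\Phi(x)R(x)\Phi(x)^\top/2\big)\end{bmatrix},\qquad \psi_k(x):=\mathrm{vec}\Big(\frac{\partial\phi(x)}{\partial x^\top}\big[f_k(x),\ G_k(x)\Phi(x)^\top\big]\Big),$$ $$L_{k,k'}(w):=\Big(\begin{bmatrix}1\\ w\end{bmatrix}\otimes I_{d_v}\Big)^{\top}\mathcal{M}\big[\psi_k\psi_{k'}^\top\big]\Big(\begin{bmatrix}1\\ w\end{bmatrix}\otimes I_{d_v}\Big)+\eta I_{d_v},$$ $$l_k(w):=\Big(\begin{bmatrix}1\\ w\end{bmatrix}\otimes I_{d_v}\Big)^{\top}\mathcal{M}\big[\psi_k\psi_0^\top\big]\begin{bmatrix}1\\ w\otimes w\end{bmatrix}.$$ *)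

(* Defs.v *)
From HB Require Import structures.
From mathcomp Require Import all_boot all_order all_algebra.
From mathcomp Require Import mxtens.
From mathcomp Require Import all_classical all_reals all_analysis measurable_realfun.
Set Implicit Arguments.
Unset Strict Implicit.
Unset Printing Implicit Defensive.
Import Order.TTheory GRing.Theory Num.Theory.
Import numFieldNormedType.Exports.
Local Open Scope classical_set_scope.
Local Open Scope ring_scope.

(* Lebesgue measure on R^n, carried by [n.-tuple R] with its product (= Borel)
   sigma-algebra: the n-fold product of [lebesgue_measure], transported from
   R * R^n to R^(n+1) along (x, t) |-> x :: t; lebesgue_tuple_box below
   characterizes it. *)
Section lebesgue_tuple.
Context {R : realType}.
Local Notation RR := (measurableTypeR R).

Definition tuple_of_pair n (x : RR * n.-tuple RR) : n.+1.-tuple RR :=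
  [the n.+1.-tuple RR of x.1 :: x.2].

Lemma measurable_tuple_of_pair n :
  measurable_fun [set: RR * n.-tuple RR] (@tuple_of_pair n).
Proof. exact: measurable_cons. Qed.

Section step.
Context (n : nat) (m : {sigma_finite_measure set (n.-tuple RR) -> \bar R}).

Definition lebesgue_tuple_step : set (n.+1.-tuple RR) -> \bar R :=
  pushforward (lebesgue_measure \x m)%E (@tuple_of_pair n).

Let step0 : lebesgue_tuple_step set0 = 0%E.
Proof. by rewrite /lebesgue_tuple_step /pushforward preimage_set0 measure0. Qed.

Let step_ge0 A : (0 <= lebesgue_tuple_step A)%E.
Proof. by rewrite /lebesgue_tuple_step /pushforward measure_ge0. Qed.

Let mpre A : measurable A -> measurable (@tuple_of_pair n @^-1` A).
Proof.
move=> mA; rewrite -[X in measurable X]setTI.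
exact: measurable_tuple_of_pair.
Qed.

Let step_sigma_additive : semi_sigma_additive lebesgue_tuple_step.
Proof.
move=> F mF tF mUF; rewrite /lebesgue_tuple_step /pushforward preimage_bigcup.
apply: measure_semi_sigma_additive.
- by move=> k; exact: mpre.
- apply/trivIsetP => /= i j _ _ ij; rewrite -preimage_setI.
  by move/trivIsetP : tF => /(_ _ _ _ _ ij) ->//; rewrite preimage_set0.
- by rewrite -preimage_bigcup; exact: mpre.
Qed.

HB.instance Definition _ := isMeasure.Build _ _ _
  lebesgue_tuple_step step0 step_ge0 step_sigma_additive.

Let pair_of_tuple (t : n.+1.-tuple RR) : RR * n.-tuple RR :=
  (thead t, [tuple of behead t]).

Let step_sigma_finite : sigma_finite setT lebesgue_tuple_step.
Proof.
have /sigma_finiteP[F [TF ndF Foo]] := sigma_finiteT (@lebesgue_measure R).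
have /sigma_finiteP[G [TG ndG Goo]] := sigma_finiteT m.
have cK : cancel (@tuple_of_pair n) pair_of_tuple.
  by case=> x t; congr pair => //; apply/val_inj.
exists (fun k => pair_of_tuple @^-1` (F k `*` G k)).
  rewrite -preimage_bigcup -[LHS](preimage_setT pair_of_tuple).
  congr (_ @^-1` _).
  rewrite -setXTT TF TG predeqE => -[x y]; split.
    move=> [/= [i _ Fix] [j _ Gjy]]; exists (maxn i j) => //; split.
    - by move: x Fix; exact/subsetPset/ndF/leq_maxl.
    - by move: y Gjy; exact/subsetPset/ndG/leq_maxr.
  by move=> [i _ []/= ? ?]; split; exists i.
move=> k; have [mF Fk] := Foo k; have [mG Gk] := Goo k; split.
  rewrite -[X in measurable X]setTI.
  have mp : measurable_fun setT pair_of_tuple.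
    apply: measurable_fun_pair; last exact: measurable_behead.
    exact: measurable_tnth.
  by apply: mp => //; exact: measurableX.
rewrite /lebesgue_tuple_step /pushforward -comp_preimage.
rewrite (_ : pair_of_tuple \o _ = id); last by apply/funext => x /=; rewrite cK.
by rewrite preimage_id product_measure1E// lte_mul_pinfty// ge0_fin_numE.
Qed.

HB.instance Definition _ := Measure_isSigmaFinite.Build _ _ _
  lebesgue_tuple_step step_sigma_finite.

End step.

Fixpoint lebesgue_tuple n :
    {sigma_finite_measure set (n.-tuple RR) -> \bar R} :=
  match n with
  | 0 => \d_([tuple] : 0.-tuple RR)
  | n'.+1 => lebesgue_tuple_step (lebesgue_tuple n')
  end.

Lemma lebesgue_tuple_box n (A : 'I_n -> set RR) :
  (forall i, measurable (A i)) ->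
  lebesgue_tuple n [set t | forall i, A i (tnth t i)] =
  (\prod_(i < n) lebesgue_measure (A i))%E.
Proof.
elim: n A => [|n ih] A mA /=.
  rewrite big_ord0 diracE mem_set//.
  by case.
rewrite big_ord_recl /= -ih// /lebesgue_tuple_step /pushforward.
rewrite -product_measure1E//.
  congr ((_ \x _)%E _); apply/seteqP; split => [[x t] /= h|[x t] [/= h0 h]].
    split => [|i] /=; first exact: (h ord0).
    by have := h (lift ord0 i); rewrite tnthS.
  move=> i; case: (unliftP ord0 i) => [j ->|->] //.
  by rewrite tnthS; exact: h.
rewrite (_ : mkset _ = \bigcap_(i in [set: 'I_n])
    ((fun t : n.-tuple RR => tnth t i) @^-1` A (lift ord0 i))).
  apply: fin_bigcap_measurable => // i _; rewrite -[X in measurable X]setTI.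
  exact: measurable_tnth.
by apply/seteqP; split => [t h i _|t h i]; [exact: h | exact: h].
Qed.

End lebesgue_tuple.

Definition col_of_tuple (R : realType) n (t : n.-tuple (measurableTypeR R)) :
  'cV[R]_n := \col_i tnth t i.

(* Column stacking: entry j * m + i of [vec A] is A i j, the same index
   convention as for the Kronecker product [*t]. *)
Definition vec (R : realType) m n (A : 'M[R]_(m, n)) : 'cV[R]_(n * m) :=
  \col_k A (mxtens_unindex k).2 (mxtens_unindex k).1.

(* No symmetry is required. *)
Definition posdefmx (R : realType) n (A : 'M[R]_n) :=
  forall y : 'cV[R]_n, y != 0 -> 0 < (y^T *m A *m y) 0 0.

Definition normsq (R : realType) n (z : 'cV[R]_n) : R := \sum_i z i 0 ^+ 2.

Definition jac (R : realType) n m (f : 'cV[R]_n -> 'cV[R]_m) (x : 'cV[R]_n) :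
  'M[R]_(m, n) :=
  \matrix_(i, j) 'D_(delta_mx j 0) (fun y => f y i 0) x.

Definition C1 (R : realType) n m (f : 'cV[R]_n -> 'cV[R]_m) :=
  (forall x, differentiable f x) /\ continuous (jac f).

(* The last conjunct reads lim_{|x| -> oo} q x != 0; the limit is not required
   to exist, and typically q x tends to +oo. *)
Definition globally_posdef (R : realType) n (q : 'cV[R]_n -> R) :=
  [/\ q 0 = 0,
      forall x, x != 0 -> 0 < q x &
      ~ (forall e, 0 < e ->
           \forall r \near +oo, forall x, r < `|x| -> `|q x| < e)].

(* \int P(x) g(x) dx for a scalar g; it may be infinite. *)
Definition weighted_integral (R : realType) n (P : 'cV[R]_n -> \bar R)
    (g : 'cV[R]_n -> R) : \bar R :=
  (\int[lebesgue_tuple n]_t (P (col_of_tuple t) * (g (col_of_tuple t))%:E))%E.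

Definition weighted_integrable (R : realType) n (P : 'cV[R]_n -> \bar R)
    (g : 'cV[R]_n -> R) :=
  (lebesgue_tuple n).-integrable setT
    (fun t => P (col_of_tuple t) * (g (col_of_tuple t))%:E)%E.

(* [fine] is harmless on the integrands of interest: products of two functions
   with P-integrable squares. *)
Definition opM (R : realType) d (P : 'cV[R]_d -> \bar R) m n
    (pi : 'cV[R]_d -> 'M[R]_(m, n)) : 'M[R]_(m, n) :=
  \matrix_(i, j) fine (weighted_integral P (fun x => pi x i j)).

(* Integrals of continuous functions against P make sense, but need not be
   finite for unbounded integrands: linearity is asked where they are, and
   boundedness is that of an operator on bounded continuous functions with the
   sup norm. *)
Record admissible_weight (R : realType) d (P : 'cV[R]_d -> \bar R) : Prop :=
  AdmissibleWeight {
    weight_ge0 : forall x, (0 <= P x)%E;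
    weight_measurable :
      measurable_fun [set: d.-tuple (measurableTypeR R)]
        (P \o @col_of_tuple R d : _ -> \bar R);
    opM_linear : forall m n (a : R) (pi1 pi2 : 'cV[R]_d -> 'M[R]_(m, n)),
      continuous pi1 -> continuous pi2 ->
      (forall i j, weighted_integrable P (fun x => pi1 x i j)) ->
      (forall i j, weighted_integrable P (fun x => pi2 x i j)) ->
      opM P (fun x => a *: pi1 x + pi2 x) = a *: opM P pi1 + opM P pi2;
    opM_bounded : exists C : R,
      forall m n (pi : 'cV[R]_d -> 'M[R]_(m, n)) (b : R),
      continuous pi -> (forall x, `|pi x| <= b) ->
      (forall i j, weighted_integrable P (fun x => pi x i j)) /\
      `|opM P pi| <= C * b }.

Record polytopic_dynamics (R : realType) dx du dtheta K
    (Stheta : set 'cV[R]_dtheta)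
    (f : 'cV[R]_dx -> 'cV[R]_dtheta -> 'cV[R]_dx)
    (G : 'cV[R]_dx -> 'cV[R]_dtheta -> 'M[R]_(dx, du))
    (h : 'I_K -> 'cV[R]_dtheta -> R)
    (fk : 'I_K -> 'cV[R]_dx -> 'cV[R]_dx)
    (Gk : 'I_K -> 'cV[R]_dx -> 'M[R]_(dx, du)) : Prop := PolytopicDynamics {
  vertices_gt0 : (0 < K)%N;
  h_continuous : forall k, {within Stheta, continuous (h k)};
  h_itv : forall k theta, Stheta theta -> 0 <= h k theta <= 1;
  h_sum : forall theta, Stheta theta -> \sum_k h k theta = 1;
  fk_lipschitz : forall k, [locally [lipschitz (fk k x) | x in setT]];
  fk0 : forall k, fk k 0 = 0;
  Gk_lipschitz : forall k, [locally [lipschitz (Gk k x) | x in setT]];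
  fE : forall x theta, Stheta theta ->
    f x theta = \sum_k h k theta *: fk k x;
  GE : forall x theta, Stheta theta ->
    G x theta = \sum_k h k theta *: Gk k x }.

Definition Jhat (R : realType) dx dv (phi : 'cV[R]_dx -> 'cV[R]_dv)
    (x : 'cV[R]_dx) (v : 'cV[R]_dv) : R := ((phi x)^T *m v) 0 0.

Definition psi_cost (R : realType) dx du dw (q : 'cV[R]_dx -> R)
    (Rc : 'cV[R]_dx -> 'M[R]_du) (Phi : 'cV[R]_dx -> 'M[R]_(dw, du))
    (x : 'cV[R]_dx) : 'cV[R]_(1 + dw * dw) :=
  col_mx (q x)%:M (vec (2^-1 *: (Phi x *m Rc x *m (Phi x)^T))).

Definition psi_dyn (R : realType) dx du dv dw
    (phi : 'cV[R]_dx -> 'cV[R]_dv) (f : 'cV[R]_dx -> 'cV[R]_dx)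
    (G : 'cV[R]_dx -> 'M[R]_(dx, du)) (Phi : 'cV[R]_dx -> 'M[R]_(dw, du))
    (x : 'cV[R]_dx) : 'cV[R]_((1 + dw) * dv) :=
  vec (jac phi x *m row_mx (f x) (G x *m (Phi x)^T)).

(* The cast only rewrites the number of columns 1 * dv into dv. *)
Definition kron_1w (R : realType) dv dw (w : 'cV[R]_dw) :
  'M[R]_((1 + dw) * dv, dv) :=
  castmx (erefl, mul1n dv) (col_mx 1%:M w *t (1%:M : 'M[R]_dv)).

Definition Lmat (R : realType) dx dv dw (P : 'cV[R]_dx -> \bar R) (eta : R)
    (psik psik' : 'cV[R]_dx -> 'cV[R]_((1 + dw) * dv)) (w : 'cV[R]_dw) :
  'M[R]_dv :=
  (kron_1w dv w)^T *m opM P (fun x => psik x *m (psik' x)^T) *m kron_1w dv w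
    + eta%:M.

Definition lvec (R : realType) dx dv dw (P : 'cV[R]_dx -> \bar R)
    (psik : 'cV[R]_dx -> 'cV[R]_((1 + dw) * dv))
    (psi0 : 'cV[R]_dx -> 'cV[R]_(1 + dw * dw)) (w : 'cV[R]_dw) : 'cV[R]_dv :=
  (kron_1w dv w)^T *m opM P (fun x => psik x *m (psi0 x)^T)
    *m col_mx 1%:M (w *t w).

Definition Ex0 (R : realType) d (Omega : measurableType d)
    (Pr : probability Omega R) dx (x0 : Omega -> 'cV[R]_dx)
    (g : 'cV[R]_dx -> R) : R :=
  fine ('E_Pr[fun o => g (x0 o)])%E.

Record random_initial_state (R : realType) d (Omega : measurableType d)
    (Pr : probability Omega R) dx (x0 : Omega -> 'cV[R]_dx) : Prop :=
  RandomInitialState {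
    x0_measurable : forall i, measurable_fun setT (fun o => x0 o i 0);
    x0_moments : forall a : 'I_dx -> nat,
      Pr.-integrable setT (fun o => (\prod_i x0 o i 0 ^+ a i)%:E) }.

(* Main.v *)
Require Import Defs.
From mathcomp Require Import all_boot all_order all_algebra.
From mathcomp Require Import perm mxtens ring lra.
From mathcomp Require Import all_classical all_reals all_analysis measurable_realfun.
Set Implicit Arguments.
Unset Strict Implicit.
Unset Printing Implicit Defensive.
Import Order.TTheory GRing.Theory Num.Theory.
Import numFieldNormedType.Exports.
Local Open Scope classical_set_scope.
Local Open Scope ring_scope.

(** Write S(w) for the h-weighted double sum of the L_kk'(w) and b(w) for the
h-weighted sum of the l_k(w), so that v = - S^-1 b. The expectation is linear
in v (Ex0_Jhat), so the gradient formula is the derivative of - S^-1 b paired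
with the mean of phi. Differentiating the identity S (S^-1 b) = b gives
S D(S^-1 b) = Db - DS (S^-1 b) (is_derive_linear_solution); this is legitimate
once S is invertible in a neighborhood of w, because S and b depend
polynomially on w (derivable_Lmat, derivable_lvec) and the inverse is a quotient
of polynomials in the entries of S, namely cofactors over the determinant.

Invertibility comes from positive definiteness. If every L_kk' is positive
definite, the convex weights h_k h_k' preserve this (posdefmx_convex). If
eta > 0, then with c = ([1; w] (x) I) y
  y^T S y = int P (sum_k h_k c^T psi_k)^2 + eta |y|^2
(Lmat_comb_posdef), where the first term is nonnegative. Reading the first term
as one integral of a square needs linearity of the P-weighted integral on the
products of entries of the psi_k. These are P-integrable since the squared
norms of the psi_k are (weighted_integrable_mul), and weighted_gram_ge0
concludes. *)

(** * Continuity of the basis functions *)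

Section continuity.
Context {R : realType}.

(** The local Lipschitz bound lives on a neighborhood of (x, x) in the product
space; continuity at x is its restriction to the pairs (x, y). *)
Lemma locally_lipschitz_continuous (V W : normedModType R) (f : V -> W) :
  [locally [lipschitz f x | x in setT]] -> continuous f.
Proof.
move=> lf x; have [M [_ lfM]] := lf (x, x) (conj I I).
have {lfM} : \forall p \near (x, x),
    `|f p.1 - f p.2| <= (`|M| + 1) * `|p.1 - p.2|.
  (* [M] may be negative: the bound is used with a larger, positive constant. *)
  have /= := lfM (`|M| + 1).
  rewrite (le_lt_trans (ler_norm M)) ?ltrDl// => /(_ isT).
  by move=> lfM'; apply: (@filterS _ (nbhs (x, x)) _ _ _ _ lfM') => p; exact.
move=> [[A B] /= [nA nB] AB].
have Ax : A x := nbhs_singleton nA.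
apply/cvgrPdist_le => e e0; near=> y.
apply: (le_trans (AB (x, y) _)) => /=; first by split => //; near: y.
rewrite -ler_pdivlMl ?ltr_wpDl//; near: y.
apply: cvgr_dist_le => //.
by rewrite mulr_gt0// invr_gt0 ltr_wpDl.
Unshelve. all: by end_near. Qed.

Lemma mx_continuousP (T : topologicalType) m n (A : T -> 'M[R]_(m, n)) :
  continuous A <-> forall i j, continuous (fun x => A x i j).
Proof.
split=> [cA i j x|cA x].
  apply: (@continuous_comp _ _ _ A (fun M : 'M[R]_(m, n) => M i j)).
    exact: cA.
  exact: coord_continuous.
apply/cvgrPdist_le => e e0; near=> y.
rewrite /Num.Def.normr/= mx_normrE (bigmax_le _ (ltW e0))//= => i _.
rewrite !mxE; move: i; near: y; apply: filter_forall => /= i.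
by apply: cvgr_dist_le => //; exact: cA.
Unshelve. all: by end_near. Qed.

Lemma continuous_sum_ord (T : topologicalType) n (g : 'I_n -> T -> R) :
  (forall i, continuous (g i)) -> continuous (fun x => \sum_i g i x).
Proof.
move=> cg x; apply: cvg_big => [|i _]; last exact: cg.
by move=> p; exact: add_continuous.
Qed.

Lemma continuous_linear_comb (T : topologicalType) (a : R) (g1 g2 : T -> R) :
  continuous g1 -> continuous g2 -> continuous (fun x => a * g1 x + g2 x).
Proof. by move=> c1 c2 x; exact: cvgD (cvgM (cvg_cst a) (c1 x)) (c2 x). Qed.

Lemma continuous_mulmx (T : topologicalType) m n p
    (A : T -> 'M[R]_(m, n)) (B : T -> 'M[R]_(n, p)) :
  continuous A -> continuous B -> continuous (fun x => A x *m B x).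
Proof.
move=> /mx_continuousP cA /mx_continuousP cB; apply/mx_continuousP => i j.
rewrite (_ : (fun x => _) = fun x => \sum_k A x i k * B x k j); last first.
  by apply/funext => x; rewrite mxE.
apply: continuous_sum_ord => k x; apply: cvgM; [exact: cA | exact: cB].
Qed.

Lemma psi_dyn_continuous dx du dv dw (phi : 'cV[R]_dx -> 'cV[R]_dv)
    (f : 'cV[R]_dx -> 'cV[R]_dx) (G : 'cV[R]_dx -> 'M[R]_(dx, du))
    (Phi : 'cV[R]_dx -> 'M[R]_(dw, du)) :
  C1 phi -> continuous f -> continuous G -> continuous Phi ->
  continuous (psi_dyn phi f G Phi).
Proof.
move=> [_ cphi] cf cG cPhi; apply/mx_continuousP => i j.
pose B x := jac phi x *m row_mx (f x) (G x *m (Phi x)^T).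
rewrite (_ : (fun x => _) =
    fun x => B x (mxtens_unindex i).2 (mxtens_unindex i).1); last first.
  by apply/funext => x; rewrite mxE.
move: (_.2) (_.1); apply/mx_continuousP; apply: continuous_mulmx => //.
have /mx_continuousP cGPhi : continuous (fun x => G x *m (Phi x)^T).
  apply: continuous_mulmx => //; apply/mx_continuousP => k l.
  rewrite (_ : (fun x => _) = fun x => Phi x l k).
    by move: l k; apply/mx_continuousP.
  by apply/funext => x; rewrite mxE.
apply/mx_continuousP => k l; have [b ->|b ->] := split_ordP l.
  rewrite (_ : (fun x => _) = fun x => f x k b).
    by move: k b; apply/mx_continuousP.
  by apply/funext => x; rewrite row_mxEl.
rewrite (_ : (fun x => _) = fun x => (G x *m (Phi x)^T) k b) //.
by apply/funext => x; rewrite row_mxEr.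
Qed.

End continuity.

(** * Integrals against the weight *)

Section weighted_integrals.
Context {R : realType} {d : nat} (P : 'cV[R]_d -> \bar R).
Context (hP : admissible_weight P).
Implicit Types g : 'cV[R]_d -> R.

Local Notation I g := (fine (weighted_integral P g)).

(** The boundedness of the operator makes P-integrable, hence measurable, the
product of P with any bounded continuous function. A continuous g is at each
point the limit, eventually constant, of its truncations to [-n, n]; since the
sequences are eventually constant the argument survives the points where P is
infinite. *)
Lemma weighted_measurable g : continuous g ->
  measurable_fun [set: d.-tuple (measurableTypeR R)]
    (fun t => P (col_of_tuple t) * (g (col_of_tuple t))%:E)%E.
Proof.
move=> cg.
pose trunc (n : nat) := cst (- n%:R) \max (g \min cst n%:R).
apply: (emeasurable_fun_cvg (fun n t =>
  P (col_of_tuple t) * (trunc n (col_of_tuple t))%:E)%E) => [n|t _].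
  have [C hC] := opM_bounded hP.
  have [|x|h _] := hC 1 1 (fun x => const_mx (trunc n x)) n%:R.
  - apply/mx_continuousP => i j.
    rewrite (_ : (fun x => _) = trunc n); last first.
      by apply/funext => x; rewrite mxE.
    apply: max_fun_continuous; first exact: cst_continuous.
    by apply: min_fun_continuous => //; exact: cst_continuous.
  - rewrite /Num.Def.normr/= mx_normrE (bigmax_le _ (ler0n _ _))//= => ij _.
    rewrite mxE ler_norml /trunc/= le_max lexx ge_max ge_min lexx orbT /= andbT.
    by rewrite -subr_ge0 opprK addr_ge0.
  have := h 0 0; rewrite /weighted_integrable.
  under eq_fun do rewrite mxE.
  exact: measurable_int.
apply: cvg_near_cst; near=> n; congr (_ * _%:E)%E.
have : `|g (col_of_tuple t)| <= n%:R by near: n; exact: nbhs_infty_ger.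
rewrite ler_norml => /andP[gn1 gn2].
by rewrite /trunc/= (min_idPl gn2) (max_idPr gn1).
Unshelve. all: by end_near. Qed.

Lemma weighted_integrable_le g g' : continuous g ->
  (forall x, `|g x| <= g' x) -> weighted_integrable P g' ->
  weighted_integrable P g.
Proof.
move=> cg gg'; apply: le_integrable => //; first exact: weighted_measurable.
move=> t _; rewrite !abseM lee_wpmul2l// lee_fin.
by rewrite (le_trans (gg' _))// ler_norm.
Qed.

(** Where P is infinite, P (a g1 + g2) differs from a P g1 + P g2 if the two
terms have opposite infinite signs. The bound by |a| |P g1| + |P g2| is safe:
multiplication distributes over sums of nonnegative extended reals. *)
Lemma weighted_integrable_linear (a : R) g1 g2 :
  continuous g1 -> continuous g2 ->
  weighted_integrable P g1 -> weighted_integrable P g2 ->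
  weighted_integrable P (fun x => a * g1 x + g2 x).
Proof.
move=> cg1 cg2 ig1 ig2.
apply: (@le_integrable _ _ _ _ _ _ _ (fun t =>
    `|a|%:E * `|P (col_of_tuple t) * (g1 (col_of_tuple t))%:E| +
    `|P (col_of_tuple t) * (g2 (col_of_tuple t))%:E|)%E) => //.
- apply: (weighted_measurable (g := fun x => a * g1 x + g2 x)).
  exact: continuous_linear_comb.
- move=> t _; set x := col_of_tuple t.
  rewrite [leRHS]gee0_abs ?adde_ge0 ?mule_ge0//.
  rewrite !abseM muleCA -ge0_muleDr ?mule_ge0//.
  rewrite lee_wpmul2l// -EFinM -EFinD lee_fin -normrM.
  exact: ler_normD.
- apply: integrableD => //; last exact: (integrable_abse ig2).
  exact: integrableZl (integrable_abse ig1).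
Qed.

(** This is the linearity of the operator at 1 x 1 matrices. Additivity of the
integral would not suffice, as the integrand is not additive in g at the points
where P is infinite. *)
Lemma weighted_integral_linear (a : R) g1 g2 :
  continuous g1 -> continuous g2 ->
  weighted_integrable P g1 -> weighted_integrable P g2 ->
  I (fun x => a * g1 x + g2 x) = a * I g1 + I g2.
Proof.
move=> cg1 cg2 ig1 ig2.
have E g : (fun x => (const_mx (g x) : 'M[R]_1) 0 0) = g.
  by apply/funext => x; rewrite mxE.
have cE g : continuous g -> continuous (fun x => const_mx (g x) : 'M[R]_1).
  move=> cg; apply/mx_continuousP => i j; rewrite !ord1.
  by rewrite (E g).
have iE g : weighted_integrable P g -> forall i j : 'I_1,
    weighted_integrable P (fun x => (const_mx (g x) : 'M[R]_1) i j).
  by move=> ig i j; rewrite !ord1 (E g).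
have /matrixP/(_ 0 0) :=
  opM_linear hP a (cE _ cg1) (cE _ cg2) (iE _ ig1) (iE _ ig2).
rewrite !mxE (E g1) (E g2) => <-; congr (fine (weighted_integral P _)).
by apply/funext => x; rewrite !mxE.
Qed.

Lemma weighted_integral_sum (T : Type) (s : seq T) (c : T -> R)
    (g : T -> 'cV[R]_d -> R) :
  (forall i, continuous (g i)) -> (forall i, weighted_integrable P (g i)) ->
  [/\ continuous (fun x => \sum_(i <- s) c i * g i x),
      weighted_integrable P (fun x => \sum_(i <- s) c i * g i x) &
      I (fun x => \sum_(i <- s) c i * g i x) = \sum_(i <- s) c i * I (g i)].
Proof.
move=> cg ig; elim: s => [|i s [cs ints Is]].
  rewrite (_ : (fun x => _) = cst 0); last first.
    by apply/funext => x; rewrite big_nil.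
  have z : (fun t : d.-tuple (measurableTypeR R) =>
      P (col_of_tuple t) * (cst (0 : R) (col_of_tuple t))%:E)%E = cst 0%E.
    by apply/funext => t; rewrite mule0.
  split; first exact: cst_continuous.
    by rewrite /weighted_integrable z; exact: integrable0.
  by rewrite /weighted_integral z integral0 big_nil.
rewrite big_cons (_ : (fun x => _) =
    fun x => c i * g i x + \sum_(j <- s) c j * g j x); last first.
  by apply/funext => x; rewrite big_cons.
split; last by rewrite weighted_integral_linear// Is.
  exact: continuous_linear_comb.
exact: weighted_integrable_linear.
Qed.

Lemma weighted_integral_ge0 g : (forall x, 0 <= g x) -> 0 <= I g.
Proof.
move=> g0; apply: fine_ge0; apply: integral_ge0 => t _.
by rewrite mule_ge0 ?lee_fin//; exact: weight_ge0.
Qed.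

(** A Gram matrix is positive semidefinite: the quadratic form is the weighted
integral of the square of sum_p a_p g_p. *)
Lemma weighted_gram_ge0 (J : finType) (a : J -> R) (g : J -> 'cV[R]_d -> R) :
  (forall p, continuous (g p)) ->
  (forall p q, weighted_integrable P (fun x => g p x * g q x)) ->
  0 <= \sum_p \sum_q a p * a q * I (fun x => g p x * g q x).
Proof.
move=> cg ig; rewrite pair_big/=.
have cgg (pq : J * J) : continuous (fun x => g pq.1 x * g pq.2 x).
  by move=> x; exact: cvgM (cg pq.1 x) (cg pq.2 x).
have [_ _ <-] := weighted_integral_sum (index_enum (J * J)%type)
  (fun pq => a pq.1 * a pq.2) cgg (fun pq => ig pq.1 pq.2).
apply: weighted_integral_ge0 => x.
rewrite (_ : \sum_(_ <- _) _ = (\sum_p a p * g p x) ^+ 2); last first.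
  rewrite expr2 big_distrlr/= pair_big/=; apply: eq_bigr => pq _.
  by rewrite mulrACA.
exact: sqr_ge0.
Qed.

Lemma weighted_integrable_normsq n (z : 'cV[R]_d -> 'cV[R]_n) :
  continuous z ->
  (weighted_integral P (fun x => normsq (z x)) < +oo)%E ->
  continuous (fun x => normsq (z x)) /\
  weighted_integrable P (fun x => normsq (z x)).
Proof.
move=> /mx_continuousP cz zoo.
have cn : continuous (fun x => normsq (z x)).
  apply: continuous_sum_ord => i x.
  by under eq_fun do rewrite expr2; exact: cvgM (cz i 0 x) (cz i 0 x).
split => //; apply/integrableP; split; first exact: (weighted_measurable cn).
move: zoo; congr (_ < _)%E; apply: eq_integral => t _.
rewrite gee0_abs// mule_ge0//; first exact: weight_ge0.
by rewrite lee_fin sumr_ge0// => i _; exact: sqr_ge0.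
Qed.

(** The product is dominated through |a b| <= a^2 + b^2. *)
Lemma weighted_integrable_mul m n (z : 'cV[R]_d -> 'cV[R]_m)
    (z' : 'cV[R]_d -> 'cV[R]_n) i j :
  continuous z -> continuous z' ->
  (weighted_integral P (fun x => normsq (z x)) < +oo)%E ->
  (weighted_integral P (fun x => normsq (z' x)) < +oo)%E ->
  weighted_integrable P (fun x => z x i 0 * z' x j 0).
Proof.
move=> cz cz' zoo z'oo.
have [cn nz] := weighted_integrable_normsq cz zoo.
have [cn' nz'] := weighted_integrable_normsq cz' z'oo.
apply: (@weighted_integrable_le _
    (fun x => 1 * normsq (z x) + normsq (z' x))); last 1 first.
- exact: weighted_integrable_linear.
- move/mx_continuousP : cz => cz; move/mx_continuousP : cz' => cz' x.
  exact: cvgM (cz i 0 x) (cz' j 0 x).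
have sq (k : nat) (y : 'cV[R]_k) l : y l 0 ^+ 2 <= normsq y.
  by rewrite /normsq (bigD1 l)//= lerDl sumr_ge0// => *; exact: sqr_ge0.
move=> x; rewrite mul1r normrM.
have := lerD (sq _ (z x) i) (sq _ (z' x) j); apply: le_trans.
rewrite -(normr_idP (sqr_ge0 (z x i 0))) -(normr_idP (sqr_ge0 (z' x j 0))).
rewrite !normrX.
have := sqr_ge0 (`|z x i 0| - `|z' x j 0|).
have := normr_ge0 (z x i 0); have := normr_ge0 (z' x j 0).
nra.
Qed.

End weighted_integrals.

(** * Differentiating the solution of a linear system *)

Section matrix_derive.
Context {R : realType} {V : normedModType R}.
Implicit Types x u : V.

Lemma is_derive_mxP m n (A : V -> 'M[R]_(m, n)) (dA : 'M[R]_(m, n)) x u :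
  is_derive x u A dA <->
  forall i j, is_derive x u (fun y => A y i j) (dA i j).
Proof.
split=> [[dAx <-] i j|dAij].
  apply: DeriveDef; first by move/derivable_mxP : dAx; exact.
  by rewrite derive_mx// mxE.
have dAx : derivable A x u.
  by apply/derivable_mxP => i j; case: (dAij i j).
apply: DeriveDef => //; rewrite derive_mx//; apply/matrixP => i j; rewrite mxE.
by case: (dAij i j).
Qed.

Lemma is_derive_mulmx m n p (A : V -> 'M[R]_(m, n)) (B : V -> 'M[R]_(n, p))
    dA dB x u :
  is_derive x u A dA -> is_derive x u B dB ->
  is_derive x u (fun y => A y *m B y) (dA *m B x + A x *m dB).
Proof.
move=> /is_derive_mxP hA /is_derive_mxP hB; apply/is_derive_mxP => i j.
rewrite (_ : (fun y => _) =
    \sum_k ((fun y => A y i k) * (fun y => B y k j))); last first.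
  by apply/funext => y; rewrite mxE fct_sumE.
have := is_derive_sum (fun k => is_deriveM (hA i k) (hB k j)).
move=> /is_derive_eq; apply.
rewrite !mxE -big_split/=; apply: eq_bigr => k _.
by rewrite addrC; congr (_ + _); exact: mulrC.
Qed.

Lemma derivable_prod_ord n (g : 'I_n -> V -> R) x u :
  (forall i, derivable (g i) x u) -> derivable (\prod_i g i) x u.
Proof.
move=> dg; elim/big_ind : _ => [|f h|//].
  by have := derivable_cst (1 : R) x u.
exact: derivableM.
Qed.

Lemma derivable_det n (A : V -> 'M[R]_n) x u :
  (forall i j, derivable (fun y => A y i j) x u) ->
  derivable (fun y => \det (A y)) x u.
Proof.
move=> dA.
rewrite (_ : (fun y => _) = \sum_(s : 'S_n)
    (cst ((-1) ^+ s) * \prod_i (fun y => A y i (s i)))); last first.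
  apply/funext => y; rewrite /determinant fct_sumE; apply: eq_bigr => s _.
  by rewrite /= fctE fct_prodE.
elim/big_ind : _ => [|f h|s _]; first by have := derivable_cst (0 : R) x u.
  exact: derivableD.
 apply: derivableM; first exact: derivable_cst.
exact: derivable_prod_ord.
Qed.

(** Cramer's rule: near x the entries of the inverse are cofactors divided by a
nonvanishing determinant. Invertibility is asked on a full neighborhood since
[invmx] is the identity on singular matrices. *)
Lemma derivable_invmx n (A : V -> 'M[R]_n) x u :
  derivable A x u -> (\forall y \near x, A y \in unitmx) ->
  derivable (fun y => invmx (A y)) x u.
Proof.
move=> /derivable_mxP dA uA; apply/derivable_mxP => i j.
apply: (@near_eq_derivable _ _ _
    ((fun y => (\det (A y))^-1) * (fun y => cofactor (A y) j i))).
  near=> y; rewrite fctE /invmx (near uA y)//.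
  by rewrite !mxE.
apply: derivableM.
  apply: derivableV; last exact: derivable_det.
  by have := nbhs_singleton uA; rewrite unitmxE unitfE.
apply: derivableM; first exact: derivable_cst.
apply: derivable_det => k l.
rewrite (_ : (fun _ => _) = (fun y => A y (lift j k) (lift i l))) //.
by apply/funext => y; rewrite !mxE.
Unshelve. all: by end_near. Qed.

(** Once X = A^-1 B is known to be derivable, its derivative is found by
differentiating A X = B, which gives DA X + A DX = DB. *)
Lemma is_derive_linear_solution n p (A : V -> 'M[R]_n) (B : V -> 'M[R]_(n, p))
    dA dB x u :
  is_derive x u A dA -> is_derive x u B dB ->
  (\forall y \near x, A y \in unitmx) ->
  is_derive x u (fun y => invmx (A y) *m B y)
    (invmx (A x) *m (dB - dA *m (invmx (A x) *m B x))).
Proof.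
move=> hA hB uA; set X := fun y => invmx (A y) *m B y.
have hI : is_derive x u (fun y => invmx (A y)) ('D_u (fun y => invmx (A y)) x).
  by apply: derivableP; apply: derivable_invmx uA; case: hA.
have hX : is_derive x u X ('D_u X x).
  by apply: derivableP; case: (is_derive_mulmx hI hB).
apply: (is_derive_eq hX).
have [_ AX] := is_derive_mulmx hA hX.
have [_ BE] := hB.
have -> : dB = dA *m X x + A x *m 'D_u X x.
  rewrite -AX -BE; apply: near_eq_derive.
  by near=> y; rewrite mulmxA mulmxV ?mul1mx//; near: y.
by rewrite addrC addKr mulmxA mulVmx ?mul1mx//; exact: nbhs_singleton uA.
Unshelve. all: by end_near. Qed.

End matrix_derive.

(** * Positive definite matrices *)

Section positive_definite.
Context {R : realType}.

Lemma posdefmx_unit n (A : 'M[R]_n) : posdefmx A -> A \in unitmx.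
Proof.
move=> pA; rewrite -row_free_unit -kermx_eq0; apply/rowV0P => v /sub_kermxP vA.
apply/eqP/negPn/negP => v0.
have := pA v^T; rewrite trmxK vA mul0mx mxE ltxx => /(_ _)/notF; apply.
by rewrite -trmx0 (inj_eq trmx_inj).
Qed.

Lemma quad_formE n (A : 'M[R]_n) (c : 'cV[R]_n) :
  (c^T *m A *m c) 0 0 = \sum_i \sum_j c i 0 * c j 0 * A i j.
Proof.
rewrite mxE exchange_big/=; apply: eq_bigr => j _.
by rewrite mxE mulr_suml; apply: eq_bigr => i _; rewrite mxE; ring.
Qed.

Lemma quad_form_comb n (T : finType) (a : T -> R) (A : T -> 'M[R]_n)
    (y : 'cV[R]_n) :
  (y^T *m (\sum_p a p *: A p) *m y) 0 0 =
  \sum_p a p * (y^T *m A p *m y) 0 0.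
Proof.
rewrite mulmx_sumr mulmx_suml summxE; apply: eq_bigr => p _.
by rewrite -scalemxAr -scalemxAl mxE.
Qed.

(** A convex combination has some h_k > 0, so the diagonal term (k, k) already
makes the quadratic form positive. *)
Lemma posdefmx_convex n (T : finType) (h : T -> R) (A : T -> T -> 'M[R]_n) :
  (forall k, 0 <= h k) -> \sum_k h k = 1 ->
  (forall k k', posdefmx (A k k')) ->
  posdefmx (\sum_k \sum_k' (h k * h k') *: A k k').
Proof.
move=> h0 h1 pA y y0; rewrite pair_big/= quad_form_comb.
have [k hk] : exists k, 0 < h k.
  have /psumr_neq0P[//|k /= hk] : \sum_k h k <> 0.
    by rewrite h1; exact/eqP/oner_neq0.
  by exists k.
rewrite (bigD1 (k, k))//= ltr_pwDl ?mulr_gt0//; first exact: pA.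
by rewrite sumr_ge0// => p _; rewrite !mulr_ge0// ltW//; exact: pA.
Qed.

End positive_definite.

Section gram.
Context {R : realType} {dx : nat} (P : 'cV[R]_dx -> \bar R).
Context (hP : admissible_weight P).

(** Since the h_k sum to 1, the regularizations add up to eta I. What remains is
the Gram form of the entries psi_k i, indexed by the pairs (k, i), with
coefficients h_k c_i. *)
Lemma Lmat_comb_posdef dv dw K
    (psi : 'I_K -> 'cV[R]_dx -> 'cV[R]_((1 + dw) * dv))
    (h : 'I_K -> R) (eta : R) (w : 'cV[R]_dw) :
  (forall k, continuous (psi k)) ->
  (forall k, weighted_integral P (fun x => normsq (psi k x)) < +oo)%E ->
  \sum_k h k = 1 -> 0 < eta ->
  posdefmx (\sum_k \sum_k' (h k * h k') *: Lmat P eta (psi k) (psi k') w).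
Proof.
move=> cpsi ipsi h1 eta0 y y0.
set c := kron_1w dv w *m y.
pose M k k' := opM P (fun x => psi k x *m (psi k' x)^T).
have LE k k' : (y^T *m Lmat P eta (psi k) (psi k') w *m y) 0 0 =
    (c^T *m M k k' *m c) 0 0 + eta * (y^T *m y) 0 0.
  rewrite /Lmat mulmxDr mulmxDl mxE; congr (_ + _).
    by rewrite /c trmx_mul !mulmxA.
  by rewrite mul_mx_scalar -scalemxAl mxE.
rewrite pair_big/= quad_form_comb.
under eq_bigr do rewrite LE mulrDr.
rewrite big_split/= -mulr_suml.
have -> : \sum_(p : 'I_K * 'I_K) h p.1 * h p.2 = 1.
  by rewrite -(pair_bigA _ (fun k k' => h k * h k'))/= -big_distrlr/= h1 mulr1.
rewrite mul1r ltr_wpDl//; last first.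
  rewrite mulr_gt0// mxE.
  have [i yi0] : exists i, y i 0 != 0.
    apply/existsP; apply: contraNT y0; rewrite negb_exists => /forallP yz.
    by apply/eqP/matrixP => i j; rewrite !ord1 mxE; exact/eqP/negPn/yz.
  rewrite (bigD1 i)//= mxE ltr_pwDl//; first by rewrite -expr2 exprn_even_gt0.
  by rewrite sumr_ge0// => k _; rewrite mxE -expr2 sqr_ge0.
have := weighted_gram_ge0 hP
  (fun p : 'I_K * 'I_((1 + dw) * dv) => h p.1 * c p.2 0)
  (g := fun p x => psi p.1 x p.2 0).
move=> /(_ _ _)/le_trans; apply.
- by move=> p; have /mx_continuousP := cpsi p.1; exact.
- by move=> p q; exact: weighted_integrable_mul.
rewrite le_eqVlt; apply/orP; left; apply/eqP.
rewrite -(pair_bigA _ (fun k k' => h k * h k' * (c^T *m M k k' *m c) 0 0))/=.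
rewrite -(pair_bigA _ (fun k i => \sum_q h k * c i 0 * (h q.1 * c q.2 0) *
  fine (weighted_integral P (fun x => psi k x i 0 * psi q.1 x q.2 0))))/=.
apply: eq_bigr => k _.
under eq_bigr => i _.
  rewrite -(pair_bigA _ (fun k' j => h k * c i 0 * (h k' * c j 0) *
    fine (weighted_integral P (fun x => psi k x i 0 * psi k' x j 0))))/=.
  over.
rewrite exchange_big/=; apply: eq_bigr => k' _.
rewrite quad_formE mulr_sumr; apply: eq_bigr => i _.
rewrite mulr_sumr; apply: eq_bigr => j _.
rewrite /M [opM _ _ _ _]mxE (_ : (fun x => (psi k x *m _) i j) =
  (fun x => psi k x i 0 * psi k' x j 0)); first by ring.
by apply/funext => x; rewrite mxE big_ord1 mxE.
Qed.

End gram.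

(** * Dependence on w of the regression matrices *)

Section polynomial_dependence.
Context {R : realType} {V : normedModType R}.
Implicit Types x u : V.

Lemma derivable_mulmx m n p (A : V -> 'M[R]_(m, n)) (B : V -> 'M[R]_(n, p))
    x u :
  derivable A x u -> derivable B x u -> derivable (fun y => A y *m B y) x u.
Proof.
by move=> /derivableP dA /derivableP dB; case: (is_derive_mulmx dA dB).
Qed.

Lemma derivable_trmx m n (A : V -> 'M[R]_(m, n)) x u :
  derivable A x u -> derivable (fun y => (A y)^T) x u.
Proof.
move=> /derivable_mxP dA; apply/derivable_mxP => i j.
rewrite (_ : (fun y => _) = fun y => A y j i)//.
by apply/funext => y; rewrite mxE.
Qed.

Lemma derivable_col_mx m1 m2 n (A : V -> 'M[R]_(m1, n)) (B : V -> 'M[R]_(m2, n))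
    x u :
  derivable A x u -> derivable B x u ->
  derivable (fun y => col_mx (A y) (B y)) x u.
Proof.
move=> /derivable_mxP dA /derivable_mxP dB; apply/derivable_mxP => i j.
have [k ->|k ->] := split_ordP i.
  rewrite (_ : (fun y => _) = fun y => A y k j)//.
  by apply/funext => y; rewrite col_mxEu.
rewrite (_ : (fun y => _) = fun y => B y k j)//.
by apply/funext => y; rewrite col_mxEd.
Qed.

Lemma derivable_tensmx m n p q (A : V -> 'M[R]_(m, n)) (B : V -> 'M[R]_(p, q))
    x u :
  derivable A x u -> derivable B x u -> derivable (fun y => A y *t B y) x u.
Proof.
move=> /derivable_mxP dA /derivable_mxP dB; apply/derivable_mxP => i j.
rewrite (_ : (fun y => _) =
    (fun y => A y (mxtens_unindex i).1 (mxtens_unindex j).1) *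
    (fun y => B y (mxtens_unindex i).2 (mxtens_unindex j).2)).
  exact: derivableM.
by apply/funext => y; rewrite mxE.
Qed.

End polynomial_dependence.

Section Lmat_lvec_derivable.
Context {R : realType} {dx dv dw : nat} (P : 'cV[R]_dx -> \bar R).
Implicit Types w u : 'cV[R]_dw.

Lemma derivable_kron_1w w u : derivable (@kron_1w R dv dw) w u.
Proof.
have /derivable_mxP dk :
    derivable (fun y => col_mx 1%:M y *t (1%:M : 'M[R]_dv)) w u.
  apply: derivable_tensmx; last exact: derivable_cst.
  by apply: derivable_col_mx; [exact: derivable_cst | exact: derivable_id].
apply/derivable_mxP => i j.
rewrite (_ : (fun y => _) = fun y => (col_mx 1%:M y *t (1%:M : 'M[R]_dv))
    i (cast_ord (esym (mul1n dv)) j))//.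
by apply/funext => y; rewrite /kron_1w castmxE/= cast_ord_id.
Qed.

Lemma derivable_Lmat (eta : R)
    (psi psi' : 'cV[R]_dx -> 'cV[R]_((1 + dw) * dv)) w u :
  derivable (Lmat P eta psi psi') w u.
Proof.
apply: derivableD; last exact: derivable_cst.
apply: derivable_mulmx; last exact: derivable_kron_1w.
apply: derivable_mulmx; last exact: derivable_cst.
exact/derivable_trmx/derivable_kron_1w.
Qed.

Lemma derivable_lvec (psi : 'cV[R]_dx -> 'cV[R]_((1 + dw) * dv))
    (psi0 : 'cV[R]_dx -> 'cV[R]_(1 + dw * dw)) w u :
  derivable (lvec P psi psi0) w u.
Proof.
apply: derivable_mulmx.
  apply: derivable_mulmx; last exact: derivable_cst.
  exact/derivable_trmx/derivable_kron_1w.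
apply: derivable_col_mx; first exact: derivable_cst.
have dw1 := @derivable_id R _ w u.
exact: (derivable_tensmx dw1 dw1).
Qed.

End Lmat_lvec_derivable.

(** * The gradient of the expected approximate cost *)

Lemma Ex0_Jhat (R : realType) d (Omega : measurableType d)
    (Pr : probability Omega R) dx dv (x0 : Omega -> 'cV[R]_dx)
    (phi : 'cV[R]_dx -> 'cV[R]_dv) (v : 'cV[R]_dv) :
  (forall i, Pr.-integrable setT (fun o => (phi (x0 o) i 0)%:E)) ->
  Ex0 Pr x0 (fun x => Jhat phi x v) =
  ((\col_i Ex0 Pr x0 (fun x => phi x i 0))^T *m v) 0 0.
Proof.
move=> iphi; rewrite /Ex0 unlock /Jhat.
under eq_integral do rewrite mxE -sumEFin.
rewrite integral_sum//=; last first.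
  move=> i; under eq_fun do rewrite mxE EFinM; exact: integrableZr.
rewrite (eq_bigr (fun i => \int[Pr]_o (phi (x0 o) i 0)%:E * (v i 0)%:E)%E).
  rewrite -sum_fine; last first.
    by move=> i _; rewrite fin_numM ?integrable_fin_num.
  rewrite mxE; apply: eq_bigr => i _.
  by rewrite fineM ?integrable_fin_num// !mxE.
move=> i _; rewrite -integralZr//; apply: eq_integral => o _.
by rewrite mxE EFinM.
Qed.

Theorem theorem3 (R : realType) (dx du dv dw dtheta K : nat)
    (d : measure_display) (Omega : measurableType d) (Pr : probability Omega R)
    (x0 : Omega -> 'cV[R]_dx)
    (Stheta : set 'cV[R]_dtheta)
    (f : 'cV[R]_dx -> 'cV[R]_dtheta -> 'cV[R]_dx)
    (G : 'cV[R]_dx -> 'cV[R]_dtheta -> 'M[R]_(dx, du))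
    (h : 'I_K -> 'cV[R]_dtheta -> R)
    (fk : 'I_K -> 'cV[R]_dx -> 'cV[R]_dx)
    (Gk : 'I_K -> 'cV[R]_dx -> 'M[R]_(dx, du))
    (q : 'cV[R]_dx -> R) (Rc : 'cV[R]_dx -> 'M[R]_du)
    (Phi : 'cV[R]_dx -> 'M[R]_(dw, du)) (phi : 'cV[R]_dx -> 'cV[R]_dv)
    (P : 'cV[R]_dx -> \bar R) (eta : R)
    (hx0 : random_initial_state Pr x0)
    (hphi_x0 : forall i, Pr.-integrable setT (fun o => (phi (x0 o) i 0)%:E))
    (hdyn : polytopic_dynamics Stheta f G h fk Gk)
    (hq_cont : continuous q) (hq : globally_posdef q)
    (hR_cont : continuous Rc)
    (hR : forall x, (Rc x)^T = Rc x /\ posdefmx (Rc x))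
    (hPhi : [locally [lipschitz (Phi x) | x in setT]])
    (hphi : C1 phi) (hphi0 : phi 0 = 0)
    (hP : admissible_weight P) (heta : 0 <= eta) :
  let psi0 := psi_cost q Rc Phi in
  let psi k := psi_dyn phi (fk k) (Gk k) Phi in
  let L k k' (w : 'cV[R]_dw) : 'M[R]_dv := Lmat P eta (psi k) (psi k') w in
  let l k (w : 'cV[R]_dw) : 'cV[R]_dv := lvec P (psi k) psi0 w in
  let Lsum w theta :=
    \sum_(k < K) \sum_(k' < K) (h k theta * h k' theta) *: L k k' w in
  let v w theta :=
    - (invmx (Lsum w theta) *m \sum_(k < K) h k theta *: l k w) in
  let gradient_formula w theta :=
    Lsum w theta \in unitmx /\
    forall j : 'I_dw,
      is_derive w (delta_mx j 0)
        (fun w' => Ex0 Pr x0 (fun x => Jhat phi x (v w' theta)))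
        (- ((\col_i Ex0 Pr x0 (fun x => phi x i 0))^T
            *m invmx (Lsum w theta)
            *m \sum_(k < K) h k theta *:
                 ('D_(delta_mx j 0) (l k) w
                  + (\sum_(k' < K) h k' theta *:
                       'D_(delta_mx j 0) (L k k') w) *m v w theta)) 0 0) in
  (weighted_integral P (fun x => normsq (psi0 x)) < +oo)%E ->
  (forall k, weighted_integral P (fun x => normsq (psi k x)) < +oo)%E ->
  (0 < eta ->
     forall w theta, Stheta theta -> gradient_formula w theta) /\
  (forall w, (\forall w' \near w, forall k k', posdefmx (L k k' w')) ->
     forall theta, Stheta theta -> gradient_formula w theta).

Proof.
move=> psi0 psi L l Lsum v gradient_formula ipsi0 ipsi.
have cpsi k : continuous (psi k).
  apply: psi_dyn_continuous => //; apply: locally_lipschitz_continuous => //.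
  - exact: fk_lipschitz hdyn k.
  - exact: Gk_lipschitz hdyn k.
(* Both cases, eta > 0 and positive definite L, reduce to invertibility on a
   neighborhood of [w]. *)
suff main w theta : (\forall w' \near w, Lsum w' theta \in unitmx) ->
    gradient_formula w theta.
  split=> [eta0 w theta Stheta_theta|w posL theta Stheta_theta]; apply: main.
    near=> w'; apply/posdefmx_unit/Lmat_comb_posdef => //.
    exact: h_sum hdyn _ Stheta_theta.
  near=> w'; apply/posdefmx_unit/posdefmx_convex.
  - by move=> k; have /andP[] := h_itv hdyn k Stheta_theta.
  - exact: h_sum hdyn _ Stheta_theta.
  - by near: w'.
move=> uL; split=> [|j]; first exact: nbhs_singleton uL.
set u := delta_mx j 0.
have dL k k' : is_derive w u (L k k') ('D_u (L k k') w).
  exact/derivableP/derivable_Lmat.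
have dl k : is_derive w u (l k) ('D_u (l k) w).
  exact/derivableP/derivable_lvec.
have dLsum : is_derive w u (Lsum ^~ theta)
    (\sum_k \sum_k' (h k theta * h k' theta) *: 'D_u (L k k') w).
  rewrite (_ : Lsum ^~ theta =
      \sum_k \sum_k' (h k theta * h k' theta) \*: L k k'); last first.
    apply/funext => w'; rewrite fct_sumE; apply: eq_bigr => k _.
    by rewrite fct_sumE.
  by apply: is_derive_sum => k; apply: is_derive_sum.
have dlsum : is_derive w u (fun w' => \sum_k h k theta *: l k w')
    (\sum_k h k theta *: 'D_u (l k) w).
  rewrite (_ : (fun w' => _) = \sum_k h k theta \*: l k); last first.
    by apply/funext => w'; rewrite fct_sumE.
  exact: is_derive_sum.
set m := \col_i _.
rewrite (_ : (fun w' => _) = fun w' => (m^T *m v w' theta) 0 0); last first.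
  by apply/funext => w'; exact: Ex0_Jhat.
have dv' := is_deriveN (is_derive_linear_solution dLsum dlsum uL).
have /is_derive_mxP/(_ 0 0) := is_derive_mulmx (is_derive_cst m^T w u) dv'.
move=> /is_derive_eq; apply.
rewrite mul0mx add0r mulmxN mxE mulmxA; congr (- (_ *m _) 0 0).
rewrite -[in LHS](mulmxN) -/(v w theta).
rewrite mulmx_suml -big_split/=; apply: eq_bigr => k _.
rewrite scalerDr scalemxAl; congr (_ + _ *m _).
rewrite scaler_sumr; apply: eq_bigr => k' _.
by rewrite scalerA.
Unshelve. all: by end_near. Qed.
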